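(* For every $\vec r=(r_A)_{A\in\underline{\mathbf 6}}$ with $r_A\in\mathbb Z_{\ge0}$ and every $n\in\mathbb Z_{\ge0}$, the moduli space $M_{Q_4}(\vec r,n)$ is connected.
   Context: Work over $\mathbb C$. Let $\underline{\mathbf 6}$ be the set of 2-element subsets of $\{1,2,3,4\}$; for $A\in\underline{\mathbf 6}$ write $A=\{a<b\}$ and let $\overline A$ be the complement of $A$ in $\{1,2,3,4\}$. Put $V=\mathbb C^n$, $W_A=\mathbb C^{r_A}$. Consider tuples $(B_a,I_A,J_A)_{a\in\{1,2,3,4\},A\in\underline{\mathbf 6}}$ with $B_a\in\mathrm{End}(V)$, $I_A\in\mathrm{Hom}(W_A,V)$, $J_A\in\mathrm{Hom}(V,W_A)$. A tuple is stable if $\sum_A\mathbb C\langle B_1,B_2,B_3,B_4\rangle\cdot I_A(W_A)=V$. The group $\mathrm{GL}(n,\mathbb C)$ acts freely on the open set $\mathcal U$ of stable tuples by $g\cdot(B_a,I_A,J_A)=(gB_ag^{-1},gI_A,J_Ag^{-1})$, and the quotient $\mathcal U/\mathrm{GL}(n,\mathbb C)$ is a smooth quasi-projective variety. $M_{Q_4}(\vec r,n)$ is the closed subscheme of this quotient cut out by the equations $$[B_a,B_b]+I_AJ_A=0,\quad J_{\overline A}I_A=0,\quad B_{\overline c}I_A=0,\quad J_AB_{\overline c}=0$$ for all $A=\{a<b\}\in\underline{\mathbf 6}$ and $\overline c\in\overline A$. *)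

(* Defs.v *)
From HB Require Import structures.
From mathcomp Require Import all_boot all_order all_algebra.
From mathcomp Require Import all_classical reals topology.

Set Implicit Arguments.
Unset Strict Implicit.
Unset Printing Implicit Defensive.

Import GRing.Theory.

Local Open Scope classical_set_scope.
Local Open Scope ring_scope.

(* The labels 1, 2, 3, 4 are represented by the elements of 'I_4. *)
Definition six : Type := {A : {set 'I_4} | #|A| == 2}.
HB.instance Definition _ := SubFinite.on six.

Lemma card_compl (A : six) : #|~: val A|%SET == 2.
Proof. by rewrite cardsCs finset.setCK (eqP (valP A)) card_ord. Qed.

Definition compl (A : six) : six := Sub (~: val A)%SET (card_compl A).

(* Elements of V = K^n and of W_A = K^(r_A) are column vectors. *)
Record tuples (K : closedFieldType) (r : six -> nat) (n : nat) := Tuples {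
  opB : 'I_4 -> 'M[K]_n ;
  opI : forall A : six, 'M[K]_(n, r A) ;
  opJ : forall A : six, 'M[K]_(r A, n)
}.

HB.instance Definition _ K r n := gen_eqMixin (tuples K r n).
HB.instance Definition _ K r n := gen_choiceMixin (tuples K r n).

Section Zariski.
Variables (K : closedFieldType) (r : six -> nat) (n : nat).
Local Notation data := (tuples K r n).

Inductive polynomial_fun : (data -> K) -> Prop :=
| Poly_cst (c : K) : polynomial_fun (fun=> c)
| Poly_B a i j : polynomial_fun (fun x => opB x a i j)
| Poly_I A i j : polynomial_fun (fun x => opI x A i j)
| Poly_J A i j : polynomial_fun (fun x => opJ x A i j)
| Poly_add f g : polynomial_fun f -> polynomial_fun g ->
    polynomial_fun (fun x => f x + g x)
| Poly_mul f g : polynomial_fun f -> polynomial_fun g ->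
    polynomial_fun (fun x => f x * g x).

Definition zero_locus (S : set (data -> K)) : set data :=
  [set x | forall f, S f -> f x = 0].

Definition zariski_open (U : set data) : Prop :=
  exists2 S, S `<=` polynomial_fun & ~` U = zero_locus S.

Lemma zariski_openT : zariski_open setT.
Proof.
exists [set (fun=> 1)] => [_ ->|]; first exact: Poly_cst.
rewrite setCT; apply/seteqP; split=> [//|x /(_ _ erefl)/eqP].
by rewrite oner_eq0.
Qed.

Lemma zariski_openI : setI_closed zariski_open.
Proof.
move=> U V [S SP SU] [T TP TV].
exists [set h | exists f g, [/\ S f, T g & h = (fun x => f x * g x)]].
  by move=> _ [f [g [/SP Pf /TP Pg ->]]]; exact: Poly_mul.
rewrite setCI SU TV; apply/seteqP; split=> [x [] Z _ [f [g [Sf Tg ->]]]|x Z].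
- by rewrite (Z _ Sf) mul0r.
- by rewrite (Z _ Tg) mulr0.
- apply: contrapT => /not_orP [/existsNP [f /not_implyP [Sf /eqP fx0]]].
  move=> /existsNP [g /not_implyP [Tg /eqP gx0]].
  have /eqP : f x * g x = 0 by apply: (Z (fun x => f x * g x)); exists f, g.
  by rewrite mulf_eq0 (negbTE fx0) (negbTE gx0).
Qed.

Lemma zariski_open_bigU (D : Type) (F : D -> set data) :
  (forall i, zariski_open (F i)) -> zariski_open (\bigcup_i F i).
Proof.
move=> oF; have /choice [S SP] : forall i, exists S : set (data -> K),
    S `<=` polynomial_fun /\ ~` F i = zero_locus S.
  by move=> i; have [S] := oF i; exists S.
exists (\bigcup_i S i) => [f [i _ Sif]|]; first exact: (SP i).1.
rewrite setC_bigcup; apply/seteqP; split=> [x Z f [i _ Sif]|x Z i _].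
- by have := Z i I; rewrite (SP i).2; apply.
- by rewrite (SP i).2 => f Sif; apply: Z; exists i.
Qed.

HB.instance Definition _ := isOpenTopological.Build data
  zariski_openT zariski_openI zariski_open_bigU.

End Zariski.

Section ModuliSpace.
Variables (K : closedFieldType) (r : six -> nat) (n : nat).
Local Notation data := (tuples K r n).

Definition word (x : data) (w : seq 'I_4) : 'M[K]_n :=
  foldr (fun a M => opB x a *m M) 1%:M w.

(* K<B_1, B_2, B_3, B_4> is spanned by the words in the B_a, so the sum over A
   of the K<B_1, B_2, B_3, B_4> . I_A(W_A) is the set of finite sums of
   vectors obtained by applying a word to an element of some I_A(W_A). *)
Definition generated (x : data) : set 'cV[K]_n :=
  [set v | exists s : seq (seq 'I_4 * {A : six & 'cV[K]_(r A)}),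
     v = \sum_(t <- s) word x t.1 *m (opI x (tag t.2) *m tagged t.2)].

Definition stable : set data := [set x | generated x = setT].

Definition act (g : 'M[K]_n) (x : data) : data :=
  Tuples (fun a => g *m opB x a *m invmx g)
         (fun A => g *m opI x A)
         (fun A => opJ x A *m invmx g).

(* As a subtype of [tuples], it carries the induced Zariski topology. *)
Definition stable_tuples : Type := set_type stable.
HB.instance Definition _ := Topological.on stable_tuples.

Definition same_orbit (x y : stable_tuples) : bool :=
  `[< exists2 g : 'M[K]_n, g \in unitmx & \val y = act g (\val x) >].

Lemma act1 x : act 1%:M x = x.
Proof.
case: x => B I J; rewrite /act /= invmx1; congr Tuples.
- by apply/funext => a; rewrite mul1mx mulmx1.
- by apply: functional_extensionality_dep => A; rewrite mul1mx.
- by apply: functional_extensionality_dep => A; rewrite mulmx1.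
Qed.

Lemma actM g h x : g \in unitmx -> h \in unitmx ->
  act g (act h x) = act (g *m h) x.
Proof.
move=> gU hU; have ghV : invmx (g *m h) = invmx h *m invmx g.
  have ghU : g *m h \in unitmx by rewrite unitmx_mul gU.
  rewrite -[RHS](mulKmx ghU) -[(g *m h) *m _]mulmxA (mulKVmx hU) (mulmxV gU).
  by rewrite mulmx1.
rewrite /act /=; congr Tuples.
- by apply/funext => a; rewrite ghV !mulmxA.
- by apply: functional_extensionality_dep => A; rewrite mulmxA.
- by apply: functional_extensionality_dep => A; rewrite ghV mulmxA.
Qed.

Lemma same_orbit_refl : reflexive same_orbit.
Proof. by move=> x; apply/asboolP; exists 1%:M; rewrite ?unitmx1 ?act1. Qed.

Lemma same_orbit_sym : symmetric same_orbit.
Proof.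
suff H x y : same_orbit x y -> same_orbit y x by move=> x y; apply/idP/idP => /H.
move=> /asboolP [g gU yE]; apply/asboolP; exists (invmx g).
  by rewrite unitmx_inv.
by rewrite yE actM ?unitmx_inv // mulVmx // act1.
Qed.

Lemma same_orbit_trans : transitive same_orbit.
Proof.
move=> y x z /asboolP [g gU yE] /asboolP [h hU zE]; apply/asboolP.
by exists (h *m g); rewrite ?unitmx_mul ?hU // zE yE actM.
Qed.

Canonical same_orbit_equiv :=
  EquivRel same_orbit same_orbit_refl same_orbit_sym same_orbit_trans.

(* The closed points of U / GL(n).  The quotient topology of the Zariski
   topology is its Zariski topology, since U -> U / GL(n) is a geometric
   quotient. *)
Definition UmodGL : Type :=
  quotient_topology {eq_quot same_orbit_equiv}%qT.
HB.instance Definition _ := Topological.on UmodGL.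
HB.instance Definition _ := Quotient.on UmodGL.

Definition equations (x : data) : Prop :=
  [/\ forall (A : six) (a b : 'I_4), val A = [set a; b]%SET -> (a < b)%N ->
        opB x a *m opB x b - opB x b *m opB x a + opI x A *m opJ x A = 0,
      forall A : six, opJ x (compl A) *m opI x A = 0,
      forall (A : six) (c : 'I_4), c \in val (compl A) -> opB x c *m opI x A = 0
    & forall (A : six) (c : 'I_4), c \in val (compl A) -> opJ x A *m opB x c = 0].

Definition M_Q4 : set UmodGL :=
  [set \pi_(UmodGL)%qT x | x in [set x : stable_tuples | equations (\val x)]].

End ModuliSpace.

(* Main.v *)
Require Import Defs.
From mathcomp Require Import all_boot all_algebra all_classical reals topology complex.
From mathcomp Require Import perm ring zify.

(* Every point of M_Q4 is joined to one and the same point by a chain of affine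
   lines, i.e. of polynomial maps K -> U landing in stable tuples that satisfy the
   equations; the image of such a line in U / GL(n) is connected.

   Fix a vector w of some W_A and a1 in A; give B_a1 weight 1, w weight 0, and the
   other B_a and the other basis vectors of the W_A weight n + 1.  Filtering V by
   the weight of the monomials B_a B_b ... I_A(e_k) and passing to the associated
   graded (a limit t -> 0) joins any point to a graded one, where J = 0 and the B_a
   commute.  The part of V of weight at most n is then K[B_a1] w.  If it is not all
   of V, let p be its last element B_a1^(k-1) w and u a basis vector of top weight,
   which is killed by all B_a.  Replacing B_a1 by B_a1 + t u p^* (or w by w + t u,
   if w = 0 in V) preserves the equations and stability, and at t = 1 the vectors
   w, B_a1 w, ..., B_a1^k w are independent: regrading yields a larger low part.
   When V = K[B_a1] w, the graded point is the Jordan block, so it is unique. *)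

Set Implicit Arguments.
Unset Strict Implicit.
Unset Printing Implicit Defensive.

Import GRing.Theory.
Local Open Scope classical_set_scope.
Local Open Scope ring_scope.

(** * Polynomial curves and linked points *)

Section Curves.
Variables (K : closedFieldType) (r : six -> nat) (n : nat).
Local Notation data := (tuples K r n).
Local Notation M := (@M_Q4 K r n).

Lemma tuples_ext (x y : data) : opB x =1 opB y -> (forall A, opI x A = opI y A) ->
  (forall A, opJ x A = opJ y A) -> x = y.
Proof.
case: x y => [B I J] [B' I' J'] /= BB II JJ.
by congr Tuples; apply: functional_extensionality_dep.
Qed.

Definition is_poly (f : K -> K) : Prop := exists p : {poly K}, forall t, f t = p.[t].

Lemma is_polyC (c : K) : is_poly (fun=> c).
Proof. by exists c%:P => t; rewrite hornerC. Qed.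

Lemma is_polyXn m : is_poly (fun t => t ^+ m).
Proof. by exists 'X^m => t; rewrite hornerXn. Qed.

Lemma is_polyD f g : is_poly f -> is_poly g -> is_poly (fun t => f t + g t).
Proof. by move=> [p fE] [q gE]; exists (p + q) => t; rewrite hornerD fE gE. Qed.

Lemma is_polyM f g : is_poly f -> is_poly g -> is_poly (fun t => f t * g t).
Proof. by move=> [p fE] [q gE]; exists (p * q) => t; rewrite hornerM fE gE. Qed.

Definition poly_curve (c : K -> data) : Prop :=
  [/\ forall a i j, is_poly (fun t => opB (c t) a i j),
      forall A i j, is_poly (fun t => opI (c t) A i j)
    & forall A i j, is_poly (fun t => opJ (c t) A i j)].

Lemma polynomial_fun_curve c f :
  poly_curve c -> polynomial_fun f -> is_poly (f \o c).
Proof.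
move=> [cB cI cJ]; elim=> //= [a|{}f g _ Pf _ Pg|{}f g _ Pf _ Pg].
- exact: is_polyC.
- exact: is_polyD.
- exact: is_polyM.
Qed.

(** Some equation of the complement of U does not vanish at [c t0]. Pulled back along c it is a
    nonzero polynomial in t, so only finitely many parameters can leave U. *)
Lemma zariski_open_curve c (U : set data) t0 : poly_curve c -> zariski_open U ->
  U (c t0) -> exists2 p : {poly K}, p != 0 & forall t, p.[t] != 0 -> U (c t).
Proof.
move=> cP [S SP SU] Ut0.
have : ~ (~` U) (c t0) by [].
rewrite SU => /existsNP [f] /not_implyP [Sf /eqP ft0].
have [p fE] := polynomial_fun_curve cP (SP _ Sf).
exists p => [|t pt0].
  by apply: contraNneq ft0 => p0; rewrite -[f _]/((f \o c) t0) fE p0 horner0.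
apply: contrapT => NU; have : (~` U) (c t) by [].
by rewrite SU => /(_ _ Sf) ft0'; move: pt0; rewrite -fE /= ft0' eqxx.
Qed.

(** Nonempty open subsets of the line are cofinite, and K is infinite, so any two of them meet. A
    relatively clopen B missing a point of the curve would give two such subsets that are
    disjoint. *)
Lemma curve_connected (c : K -> stable_tuples K r n) :
  poly_curve (val \o c) -> connected [set \pi_(UmodGL K r n)%qT (c t) | t in setT].
Proof.
move=> cP.
have openP (C : set (UmodGL K r n)) t0 : open C ->
    C (\pi_(UmodGL K r n)%qT (c t0)) -> exists2 p : {poly K}, p != 0 &
      forall t, p.[t] != 0 -> C (\pi_(UmodGL K r n)%qT (c t)).
  move=> [W oW WE] Ct0.
  have WC t : C (\pi_(UmodGL K r n)%qT (c t)) = W (val (c t)).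
    by rewrite -[LHS]/((\pi_(UmodGL K r n)%qT @^-1` C) (c t)) -WE.
  have : W (val (c t0)) by rewrite -WC.
  move=> /(zariski_open_curve cP oW)[p p0 pW].
  by exists p => // t /pW; rewrite WC.
move=> B [b Bb] [C oC BC] [D cD BD]; rewrite BD.
have [t1 Ct1] : exists t, C (\pi_(UmodGL K r n)%qT (c t)).
  by move: Bb; rewrite BC => -[[t _ <-]]; exists t.
apply/seteqP; split=> [y []//|_ [t0 _ <-]]; split; first by exists t0.
apply: contrapT => ND.
have oD : open (~` D) by exact: closed_openC.
have [p p0 pC] := openP _ _ oC Ct1.
have [q q0 qD] := openP _ _ oD ND.
have /closed_nonrootP [t] : p * q != 0 by rewrite mulf_neq0.
rewrite rootE hornerM mulf_eq0 negb_or => /andP [/pC Ct /qD]; apply.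
suff : ([set \pi_(UmodGL K r n)%qT (c t) | t in setT] `&` D)
  (\pi_(UmodGL K r n)%qT (c t)) by case.
by rewrite -BD BC; split=> //; exists t.
Qed.

(** Stated on tuples rather than on orbits, so that curves and changes of basis can be chained. The
    stability proofs are needed to name the two points of the quotient. *)
Definition linked (x y : data) : Prop := exists (sx : stable x) (sy : stable y),
  connected_component M (\pi_(UmodGL K r n)%qT (SigSub (mem_set sx)))
                        (\pi_(UmodGL K r n)%qT (SigSub (mem_set sy))).

Lemma linked_sym x y : linked x y -> linked y x.
Proof. by move=> [sx [sy xy]]; exists sy, sx; exact: connected_component_sym. Qed.

Lemma linked_trans y x z : linked x y -> linked y z -> linked x z.
Proof.
move=> [sx [sy xy]] [sy' [sz yz]]; exists sx, sz.
rewrite (Prop_irrelevance sy sy') in xy.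
exact: connected_component_trans xy yz.
Qed.

Lemma linked_curve (c : K -> data) s t : poly_curve c ->
  (forall t, stable (c t)) -> (forall t, equations (c t)) -> linked (c s) (c t).
Proof.
move=> cP cS cE; exists (cS s), (cS t).
pose d t : stable_tuples K r n := SigSub (mem_set (cS t)).
exists [set \pi_(UmodGL K r n)%qT (d t) | t in setT]; last by exists t.
split; first by exists s.
- by move=> _ [u _ <-]; exists (d u) => //; exact: cE.
- exact: curve_connected.
Qed.

Lemma linked_act g x : g \in unitmx -> stable x -> stable (act g x) ->
  equations x -> linked x (act g x).
Proof.
move=> gU sx sgx ex; exists sx, sgx.
set a := \pi_(_)%qT _; set b := \pi_(_)%qT _.
suff <- : a = b by apply: connected_component_refl; exists (SigSub (mem_set sx)).
by apply/eqquotP/asboolP; exists g.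
Qed.

End Curves.

(** * Monomial vectors *)

Section Monomials.
Variables (K : closedFieldType) (r : six -> nat) (n : nat).
Local Notation data := (tuples K r n).
Implicit Types x y z : data.

(** The standard basis of the direct sum of all the W_A. *)
Definition gen : Type := {A : six & 'I_(r A)}.
Local Notation Gen k := (Tagged (fun A : six => 'I_(r A)) k).
Definition monomial : Type := seq 'I_4 * gen.

Definition mvec (x : data) (m : monomial) : 'cV[K]_n :=
  col (tagged m.2) (word x m.1 *m opI x (tag m.2)).

Lemma mvec_cons x a p w : mvec x (a :: p, w) = opB x a *m mvec x (p, w).
Proof. by rewrite /mvec /= -mulmxA !colE !mulmxA. Qed.

Lemma mvec_nil x (w : gen) : mvec x ([::], w) = col (tagged w) (opI x (tag w)).
Proof. by rewrite /mvec /= mul1mx. Qed.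

Lemma mvec_mulcV x p A (v : 'cV[K]_(r A)) :
  word x p *m (opI x A *m v) = \sum_k v k 0 *: mvec x (p, Gen k).
Proof.
rewrite mulmxA; apply/colP => i; rewrite !mxE summxE; apply: eq_bigr => k _.
by rewrite /mvec !mxE /= mulrC.
Qed.

Lemma generated_mvec x m : generated x (mvec x m).
Proof.
exists [:: (m.1, Tagged (fun A => 'cV[K]_(r A)) (delta_mx (tagged m.2) 0))].
by rewrite big_seq1 /= /mvec colE mulmxA.
Qed.

Lemma generated_sum x (I : finType) (F : I -> 'cV[K]_n) :
  (forall i, generated x (F i)) -> generated x (\sum_i F i).
Proof.
move=> /choice [s sE]; exists (flatten [seq s i | i <- enum I]).
by rewrite big_flatten big_map big_enum /=; apply: eq_bigr => i _.
Qed.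

Lemma generatedZ x c v : generated x v -> generated x (c *: v).
Proof.
pose scale (t : seq 'I_4 * {A : six & 'cV[K]_(r A)}) :=
  (t.1, Tagged (fun A : six => 'cV[K]_(r A)) (c *: tagged t.2)).
move=> [s ->]; exists (map scale s).
rewrite big_map scaler_sumr.
by apply: eq_bigr => t _ /=; rewrite -!scalemxAr.
Qed.

Lemma generatedD x u v : generated x u -> generated x v -> generated x (u + v).
Proof. by move=> [s ->] [t ->]; exists (s ++ t); rewrite big_cat. Qed.

Lemma generated_opB x a v : generated x v -> generated x (opB x a *m v).
Proof.
move=> [s ->]; exists [seq (a :: t.1, t.2) | t <- s].
by rewrite big_map mulmx_sumr; apply: eq_bigr => t _ /=; rewrite !mulmxA.
Qed.

Lemma generated_opI x (w : gen) : generated x (col (tagged w) (opI x (tag w))).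
Proof. by rewrite -mvec_nil; exact: generated_mvec. Qed.

Lemma stable_generated x (P : 'M[K]_n) : P \in unitmx ->
  (forall i, generated x (col i P)) -> stable x.
Proof.
move=> PU gP; apply/seteqP; split=> // v _.
have -> : v = \sum_i (invmx P *m v) i 0 *: col i P.
  rewrite -[LHS](mulKVmx PU); apply/colP => j.
  by rewrite !mxE summxE; apply: eq_bigr => i _; rewrite !mxE mulrC.
by apply: generated_sum => i; apply: generatedZ.
Qed.

(** Each standard basis vector is a finite sum of words applied to vectors of the W_A. Expanding the
    latter in coordinates leaves a finite list of monomial vectors that spans V, from which a basis
    is extracted. *)
Lemma stable_basis x : stable x ->
  exists f : 'I_n -> monomial, (\matrix_(i, j) mvec x (f j) i 0) \in unitmx.
Proof.
move=> sx.
have /choice [s sE] : forall i : 'I_n, generated x (delta_mx i 0).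
  by move=> i; rewrite sx.
pose ms (t : seq 'I_4 * {A : six & 'cV[K]_(r A)}) : seq monomial :=
  [seq (t.1, Gen k) | k <- enum 'I_(r (tag t.2))].
pose L : seq monomial := flatten [seq flatten (map ms (s i)) | i <- enum 'I_n].
pose A := \matrix_(j < size L) (mvec x (tnth (in_tuple L) j))^T.
have LA m : m \in L -> ((mvec x m)^T <= A)%MS.
  move=> mL; have /tnthP [j ->] : m \in in_tuple L by [].
  have -> : (mvec x (tnth (in_tuple L) j))^T = row j A.
    by rewrite rowK.
  exact: row_sub.
have fA : row_full A.
  rewrite -sub1mx; apply/row_subP => i; rewrite row1 -[delta_mx _ _]trmxK trmx_delta sE.
  rewrite linear_sum big_seq summx_sub // => t ts.
  rewrite mvec_mulcV linear_sum summx_sub // => k _.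
  rewrite linearZ scalemx_sub // LA //; apply/flatten_mapP; exists i; first by rewrite mem_enum.
  by apply/flatten_mapP; exists t => //; apply/mapP; exists k; rewrite ?mem_enum.
exists (fun j => tnth (in_tuple L) (fullrankfun fA j)).
rewrite -unitmx_tr; set P := (X in X \in _).
have -> : P = rowsub (fullrankfun fA) A by apply/matrixP => i j; rewrite !mxE.
exact: fullrowsub_unit.
Qed.

End Monomials.

(** * Weights and adapted bases *)

Section Weights.
Variables (K : closedFieldType) (r : six -> nat) (n : nat).
Local Notation data := (tuples K r n).
Local Notation gen := (gen r).
Local Notation Gen k := (Tagged (fun A : six => 'I_(r A)) k).
Local Notation monomial := (monomial r).
Implicit Types x y z : data.
Variables (dB : 'I_4 -> nat) (dW : gen -> nat).

Definition wt (m : monomial) : nat := \sum_(a <- m.1) dB a + dW m.2.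

Lemma wt_cons a p w : wt (a :: p, w) = (dB a + wt (p, w))%N.
Proof. by rewrite /wt /= big_cons addnA. Qed.

Lemma wt_nil w : wt ([::], w) = dW w.
Proof. by rewrite /wt big_nil. Qed.

(** For each s, the span of the monomial vectors of weight at most s is then the span of the e_i
    with [deg i <= s]: the first clause gives one inclusion, the second the other. *)
Definition adapted x (deg : 'I_n -> nat) : Prop :=
  (forall m i, mvec x m i 0 != 0 -> (deg i <= wt m)%N) /\
  (forall i, exists2 m, mvec x m = delta_mx i 0 & wt m = deg i).

Lemma stable_adapted x deg : adapted x deg -> stable x.
Proof.
move=> [_ xe]; apply: (stable_generated (P := 1%:M)) => [|i]; first exact: unitmx1.
have [m me _] := xe i; rewrite col1 -me; exact: generated_mvec.
Qed.

Definition mvec_mx x (f : 'I_n -> monomial) : 'M[K]_n := \matrix_(i, j) mvec x (f j) i 0.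

Lemma word_act g x p : g \in unitmx -> word (act g x) p = g *m word x p *m invmx g.
Proof.
move=> gU; elim: p => [|a p IH] /=; first by rewrite mulmx1 mulmxV.
by rewrite IH !mulmxA mulmxKV.
Qed.

Lemma mvec_act g x m : g \in unitmx -> mvec (act g x) m = g *m mvec x m.
Proof. by move=> gU; rewrite /mvec word_act // !colE /= !mulmxA mulmxKV. Qed.

(* A basis of monomial vectors of minimal total weight: exchanging one of its
   elements against a lighter monomial vector involving it would decrease the
   total weight. *)
Lemma minimal_basis x : stable x -> exists2 f, mvec_mx x f \in unitmx &
  forall m i, (invmx (mvec_mx x f) *m mvec x m) i 0 != 0 -> (wt (f i) <= wt m)%N.
Proof.
move=> /stable_basis [f0 f0U].
pose isw k := `[< exists2 f, mvec_mx x f \in unitmx & (\sum_i wt (f i))%N = k >].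
have [|k /asboolP [f fU fk] kmin] := @ex_minnP isw.
  by exists (\sum_i wt (f0 i))%N; apply/asboolP; exists f0.
exists f => // m i; set P := mvec_mx x f => mi; rewrite leqNgt; apply/negP => lt_m.
pose f' j := if j == i then m else f j.
(* This prepares Cramer's rule. The two matrices differ only in column i, so if the new determinant
   vanished, coordinate i of [mvec x m] in the old basis would vanish too. *)
have cof j : cofactor (mvec_mx x f') j i = cofactor P j i.
  congr (_ * \det _); apply/matrixP => u v; rewrite !mxE /f'.
  by rewrite eq_sym (negbTE (neq_lift i v)).
have f'U : mvec_mx x f' \in unitmx.
  rewrite unitmxE (expand_det_col _ i) unitfE; move: mi; apply: contra_neq => d0.
  rewrite /invmx fU -scalemxAl mxE; apply/eqP; rewrite mulf_eq0; apply/orP; right.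
  apply/eqP; rewrite -[RHS]d0 mxE; apply: eq_bigr => j _.
  by rewrite cof !mxE /f' eqxx mulrC.
have := kmin (\sum_j wt (f' j))%N; rewrite leqNgt => /(_ _)/negP; apply.
  by apply/asboolP; exists f'.
rewrite -fk (bigD1 i) //= [X in (_ < X)%N](bigD1 i) //= {1}/f' eqxx.
rewrite (eq_bigr (fun j => wt (f j))) => [|j /negbTE ji]; last by rewrite /f' ji.
by rewrite ltn_add2r.
Qed.

Lemma adapted_act x : stable x ->
  exists g deg, g \in unitmx /\ adapted (act g x) deg.
Proof.
move=> /minimal_basis [f fU fmin].
exists (invmx (mvec_mx x f)), (wt \o f); rewrite unitmx_inv; split=> //.
have gU : invmx (mvec_mx x f) \in unitmx by rewrite unitmx_inv.
split=> [m i|i]; first by rewrite mvec_act //; exact: fmin.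
exists (f i) => //; rewrite mvec_act //.
have -> : mvec x (f i) = col i (mvec_mx x f) by apply/colP => j; rewrite !mxE.
by rewrite colE mulKmx.
Qed.

Section Adapted.
Variables (x : data) (deg : 'I_n -> nat).
Hypothesis xdeg : adapted x deg.

Lemma adapted_opB a i j : opB x a i j != 0 -> (deg i <= dB a + deg j)%N.
Proof.
have [[p w] me <-] := xdeg.2 j; move=> aij.
rewrite -wt_cons; apply: xdeg.1.
by rewrite mvec_cons me -colE mxE.
Qed.

Lemma adapted_opI A i k : opI x A i k != 0 -> (deg i <= dW (Gen k))%N.
Proof. by move=> aik; rewrite -wt_nil; apply: xdeg.1; rewrite mvec_nil mxE. Qed.

End Adapted.

End Weights.

(** * Degeneration to the associated graded tuple *)

Section Rescale.
Variable K : closedFieldType.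

(** In terms of the weight filtrations, M raises the weight by at most s. *)
Definition filtered p q (s : nat) (row : 'I_p -> nat) (cl : 'I_q -> nat)
  (M : 'M[K]_(p, q)) := forall i j, M i j != 0 -> (row i <= s + cl j)%N.

(** For t nonzero and M filtered this is t^s D^-1 M D', with D and D' the diagonal matrices of the
    powers of t given by [row] and [cl]. The truncated subtraction is then exact at every nonzero
    entry of M, so the formula extends to t = 0. *)
Definition rescale p q (s : nat) (row : 'I_p -> nat) (cl : 'I_q -> nat) (t : K)
  (M : 'M[K]_(p, q)) : 'M[K]_(p, q) := \matrix_(i, j) (t ^+ (s + cl j - row i) * M i j).

Lemma rescaleM p q l s1 s2 (d : 'I_p -> nat) (e : 'I_q -> nat) (f : 'I_l -> nat) t M N :
  filtered s1 d e M -> filtered s2 e f N ->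
  rescale s1 d e t M *m rescale s2 e f t N = rescale (s1 + s2) d f t (M *m N).
Proof.
move=> fM fN; apply/matrixP => i k; rewrite !mxE mulr_sumr; apply: eq_bigr => j _.
rewrite !mxE mulrACA -exprD.
have [->|Mij] := eqVneq (M i j) 0; first by rewrite !(mul0r, mulr0).
have [->|Njk] := eqVneq (N j k) 0; first by rewrite !mulr0.
congr (t ^+ _ * _); have := fM _ _ Mij; have := fN _ _ Njk; lia.
Qed.

Lemma filteredM p q l s1 s2 (d : 'I_p -> nat) (e : 'I_q -> nat) (f : 'I_l -> nat) M N :
  filtered s1 d e M -> filtered s2 e f N -> filtered (s1 + s2) d f (M *m N).
Proof.
move=> fM fN i k; rewrite mxE; apply: contra_neqT; rewrite -ltnNge => lt_ik.
apply: big1 => j _; apply/eqP; rewrite mulf_eq0.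
have [|Mij] := eqVneq (M i j) 0 => //=; apply: contraTT lt_ik => Njk.
have := fM _ _ Mij; have := fN _ _ Njk; lia.
Qed.

Lemma rescaleD p q s (d : 'I_p -> nat) (e : 'I_q -> nat) t M N :
  rescale s d e t (M + N) = rescale s d e t M + rescale s d e t N.
Proof. by apply/matrixP => i j; rewrite !mxE mulrDr. Qed.

Lemma rescaleN p q s (d : 'I_p -> nat) (e : 'I_q -> nat) t M :
  rescale s d e t (- M) = - rescale s d e t M.
Proof. by apply/matrixP => i j; rewrite !mxE mulrN. Qed.

Lemma rescale0 p q s (d : 'I_p -> nat) (e : 'I_q -> nat) t : rescale s d e t 0 = 0.
Proof. by apply/matrixP => i j; rewrite !mxE mulr0. Qed.

Lemma rescale_1mx p (d : 'I_p -> nat) t : rescale 0 d d t 1%:M = 1%:M.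
Proof.
apply/matrixP => i j; rewrite !mxE add0n.
by have [->|_] := eqVneq; rewrite ?subnn ?mulr1 ?mulr0.
Qed.

Lemma rescale_at0 p q s (d : 'I_p -> nat) (e : 'I_q -> nat) M i j :
  rescale s d e 0 M i j != 0 -> (s + e j <= d i)%N.
Proof. by rewrite mxE expr0n subn_eq0; case: leqP => //= _; rewrite mul0r eqxx. Qed.

End Rescale.

Section Degeneration.
Variables (K : closedFieldType) (r : six -> nat) (n : nat).
Local Notation data := (tuples K r n).
Local Notation gen := (gen r).
Local Notation Gen k := (Tagged (fun A : six => 'I_(r A)) k).
Local Notation monomial := (monomial r).
Implicit Types x y z : data.
Variables (dB : 'I_4 -> nat) (dW : gen -> nat).

Definition graded x (deg : 'I_n -> nat) : Prop :=
  [/\ adapted dB dW x deg, equations x, opJ x = fun=> 0,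
      forall a i j, opB x a i j != 0 -> deg i = (dB a + deg j)%N
    & forall A i k, opI x A i k != 0 -> deg i = dW (Gen k)].

Hypothesis dW_lt : forall (A : six) (k : 'I_(r A)), (dW (Gen k) < \sum_(a in val A) dB a)%N.

Variables (x : data) (deg : 'I_n -> nat).
Hypotheses (xdeg : adapted dB dW x deg) (xeq : equations x).

(** The weight given to J makes I_A J_A as heavy as [B_a, B_b], so that the equations are
    homogeneous. By [dW_lt] every exponent of t in J is positive, which kills J at t = 0. *)
Definition degeneration (t : K) : data :=
  Tuples (fun a => rescale (dB a) deg deg t (opB x a))
         (fun A => rescale 0 deg (fun k => dW (Gen k)) t (opI x A))
         (fun A => rescale (\sum_(a in val A) dB a) (fun k => dW (Gen k)) deg t (opJ x A)).

Local Lemma opB_filtered a : filtered (dB a) deg deg (opB x a).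
Proof. by move=> i j; exact: (adapted_opB xdeg). Qed.

Local Lemma opI_filtered A : filtered 0 deg (fun k => dW (Gen k)) (opI x A).
Proof. by move=> i j; exact: (adapted_opI xdeg). Qed.

Local Lemma opJ_filtered (A : six) :
  filtered (\sum_(a in val A) dB a) (fun k => dW (Gen k)) deg (opJ x A).
Proof. by move=> i j _; have := dW_lt i; lia. Qed.

Lemma word_filtered p : filtered (\sum_(a <- p) dB a) deg deg (word x p).
Proof.
elim: p => [i j|a p IH] /=; last by rewrite big_cons; exact: filteredM (@opB_filtered a) IH.
by rewrite mxE; case: (eqVneq i j) => [->|_]; rewrite ?eqxx ?leq_addl.
Qed.

Lemma word_degeneration t p :
  word (degeneration t) p = rescale (\sum_(a <- p) dB a) deg deg t (word x p).
Proof.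
elim: p => [|a p IH] /=; first by rewrite big_nil rescale_1mx.
by rewrite IH big_cons rescaleM //; [exact: opB_filtered|exact: word_filtered].
Qed.

Lemma mvec_degeneration t m i :
  mvec (degeneration t) m i 0 = t ^+ (wt dB dW m - deg i) * mvec x m i 0.
Proof.
case: m => p [A k]; rewrite /mvec word_degeneration mxE rescaleM; last 2 first.
- exact: word_filtered.
- exact: opI_filtered.
by rewrite addn0 !mxE.
Qed.

(** A monomial of weight [deg i] with value e_i keeps this value for all t: its only nonzero
    coordinate carries t^0. Hence stability survives at t = 0. *)
Lemma degeneration_adapted t : adapted dB dW (degeneration t) deg.
Proof.
split=> [m i|i]; first by rewrite mvec_degeneration mulf_eq0 negb_or => /andP[_ /xdeg.1].
have [m me mi] := xdeg.2 i; exists m => //; apply/colP => j.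
rewrite mvec_degeneration me mxE mi; case: eqVneq => [->|_]; last by rewrite mulr0.
by rewrite subnn mul1r.
Qed.

Lemma degeneration_equations t : equations (degeneration t).
Proof.
have [xBB xJI xBI xJB] := xeq; split=> [A a b Aab ab|A|A c Ac|A c Ac] /=.
- have sumA : (\sum_(a in val A) dB a = dB a + dB b)%N.
    by rewrite Aab big_setU1 ?big_set1 // inE neq_ltn ab.
  rewrite !rescaleM; [|exact: opI_filtered|exact: opJ_filtered|exact: opB_filtered..].
  by rewrite sumA add0n [X in _ - rescale X _ _ _ _]addnC -rescaleN -!rescaleD xBB // rescale0.
- by rewrite rescaleM ?xJI ?rescale0 //; [exact: opJ_filtered|exact: opI_filtered].
- by rewrite rescaleM ?xBI ?rescale0 //; [exact: opB_filtered|exact: opI_filtered].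
- by rewrite rescaleM ?xJB ?rescale0 //; [exact: opJ_filtered|exact: opB_filtered].
Qed.

Lemma degeneration_graded : graded (degeneration 0) deg.
Proof.
have adeg := degeneration_adapted 0.
split=> //= [|||].
- exact: degeneration_equations.
- apply: functional_extensionality_dep => A; apply/matrixP => k j; rewrite [RHS]mxE.
  apply/eqP/negP => /negP /rescale_at0 le_k.
  by have := leq_ltn_trans (leq_trans (leq_addr _ _) le_k) (dW_lt k); rewrite ltnn.
- move=> a i j aij; have := adapted_opB adeg aij.
  have := rescale_at0 aij; lia.
- move=> A i k aij; have := adapted_opI adeg aij.
  have := rescale_at0 aij; lia.
Qed.

Lemma degeneration_poly_curve : poly_curve degeneration.
Proof.
suff polyR p q s (d : 'I_p -> nat) (e : 'I_q -> nat) (M : 'M[K]_(p, q)) i j :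
    is_poly (fun t => rescale s d e t M i j) by split=> *; exact: polyR.
under [X in is_poly X]funext do rewrite mxE.
by apply: is_polyM; [exact: is_polyXn|exact: is_polyC].
Qed.

Lemma degeneration1 : degeneration 1 = x.
Proof.
apply: tuples_ext => A; apply/matrixP => i j; by rewrite mxE expr1n mul1r.
Qed.

Lemma linked_degeneration : linked x (degeneration 0).
Proof.
rewrite -{1}degeneration1; apply: linked_curve => [|t|t].
- exact: degeneration_poly_curve.
- exact: stable_adapted (degeneration_adapted t).
- exact: degeneration_equations.
Qed.

End Degeneration.

(** * Socle perturbations *)

Section Perturbation.
Variables (K : closedFieldType) (r : six -> nat) (n : nat).
Local Notation data := (tuples K r n).
Local Notation Gen k := (Tagged (fun A : six => 'I_(r A)) k).
Implicit Types x y z : data.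
Variables (x : data) (u : 'cV[K]_n) (beta : 'I_4 -> 'rV[K]_n).
Variable gamma : forall A : six, 'rV[K]_(r A).

(** Rank one changes with values in the line of u. Below, u is killed by all the B_a; [beta]
    lengthens a nonempty chain of powers, while [gamma] starts the chain. *)
Definition perturb (t : K) : data :=
  Tuples (fun a => opB x a + t *: (u *m beta a))
         (fun A => opI x A + t *: (u *m gamma A)) (opJ x).

Lemma perturb0 : perturb 0 = x.
Proof.
by apply: tuples_ext => A //=; rewrite scale0r addr0.
Qed.

Lemma perturb_poly_curve : poly_curve perturb.
Proof.
split=> [a|A|A] i j /=; last exact: is_polyC.
all: under [X in is_poly X]funext do rewrite mxE [in X in _ + X]mxE mulrC.
all: apply: is_polyD; first exact: is_polyC.
all: by apply: is_polyM; [exact: is_polyC|exact: (is_polyXn _ 1)].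
Qed.

(** Old and new operators differ by multiples of u. Once u is generated, induction on the word shows
    that the old monomial vectors are generated as well. *)
Lemma perturb_stable t : stable x -> generated (perturb t) u -> stable (perturb t).
Proof.
move=> /stable_basis [f fU] gu.
have gx m : generated (perturb t) (mvec x m).
  case: m => p w; elim: p => [|a p IH].
    rewrite mvec_nil.
    have -> : col (tagged w) (opI x (tag w)) =
      col (tagged w) (opI (perturb t) (tag w)) + - (t * gamma (tag w) 0 (tagged w)) *: u.
      apply/colP => i; rewrite !mxE big_ord1; ring.
    by apply: generatedD; [exact: generated_opI|exact: generatedZ].
  rewrite mvec_cons.
  have -> : opB x a *m mvec x (p, w) = opB (perturb t) a *m mvec x (p, w) +
      - (t * (beta a *m mvec x (p, w)) 0 0) *: u.
    set c := (_ *m _) 0 0; have bc : beta a *m mvec x (p, w) = c%:M by exact: mx11_scalar.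
    by rewrite /= mulmxDl -scalemxAl -mulmxA bc mul_mx_scalar scalerA scaleNr addrK.
  by apply: generatedD; [exact: generated_opB|exact: generatedZ].
apply: (stable_generated fU) => i.
by have -> : col i (\matrix_(i, j) mvec x (f j) i 0) = mvec x (f i);
  [apply/colP => j; rewrite !mxE|exact: gx].
Qed.

Hypotheses (xeq : equations x) (xJ : opJ x = fun=> 0).
Hypotheses (Bu : forall a, opB x a *m u = 0) (bu : forall a, beta a *m u = 0).
Hypothesis bB : forall a b, beta a *m opB x b = beta b *m opB x a.
Hypothesis bI : forall (A : six) c, c \in val (compl A) -> beta c *m opI x A = 0.

Lemma perturb_equations t : equations (perturb t).
Proof.
have [xBB _ xBI _] := xeq.
have Buv a q (v : 'rV_q) : opB x a *m (u *m v) = 0 by rewrite mulmxA Bu mul0mx.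
have ubuv a q (v : 'rV_q) : u *m beta a *m (u *m v) = 0.
  by rewrite mulmxA -(mulmxA u) bu mulmx0 mul0mx.
split=> [A a b Aab ab|A|A c Ac|A c Ac] /=.
- have := xBB A a b Aab ab; rewrite xJ !mulmx0 !addr0 => /eqP; rewrite subr_eq0 => /eqP xab.
  (* Since B u = 0 and beta u = 0, only the term u beta_a B_b survives, and by [bB] it is symmetric
     in a and b. *)
  have BB a' b' : (opB x a' + t *: (u *m beta a')) *m (opB x b' + t *: (u *m beta b')) =
     opB x a' *m opB x b' + t *: (u *m (beta a' *m opB x b')).
    rewrite mulmxDl !mulmxDr -!scalemxAr -!scalemxAl Buv ubuv !scaler0 !addr0.
    by rewrite mulmxA.
  by rewrite !BB bB xab subrr.
- by rewrite xJ mul0mx.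
- rewrite mulmxDl !mulmxDr -!scalemxAr -!scalemxAl !mulmxA Bu xBI //.
  by rewrite -!(mulmxA u) bu bI // !(mulmx0, mul0mx, scaler0, addr0).
- by rewrite xJ mul0mx.
Qed.

Hypotheses (sx : stable x) (gu : forall t, t != 0 -> generated (perturb t) u).

Lemma perturb_stable_all t : stable (perturb t).
Proof.
have [->|/gu] := eqVneq t 0; first by rewrite perturb0.
exact: perturb_stable.
Qed.

Lemma linked_perturb t : linked x (perturb t).
Proof.
rewrite -{1}perturb0; apply: linked_curve.
- exact: perturb_poly_curve.
- exact: perturb_stable_all.
- exact: perturb_equations.
Qed.

End Perturbation.

(** * Growing the low part *)

Section Main.
Variables (K : closedFieldType) (r : six -> nat) (n : nat).
Local Notation data := (tuples K r n).
Local Notation gen := (gen r).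
Local Notation Gen k := (Tagged (fun A : six => 'I_(r A)) k).
Local Notation monomial := (monomial r).
Implicit Types (x y z : data) (deg : 'I_n -> nat).

Lemma equations_act g x : g \in unitmx -> equations x -> equations (act g x).
Proof.
move=> gU [xBB xJI xBI xJB]; split=> [A a b Aab ab|A|A c Ac|A c Ac] /=.
- have /(congr1 (fun M => g *m M *m invmx g)) := xBB A a b Aab ab.
  by rewrite mulmxDr mulmxBr mulmxDl mulmxBl mulmx0 mul0mx !mulmxA !(mulmxKV gU).
- by rewrite mulmxA mulmxKV ?xJI.
- by rewrite mulmxA mulmxKV // -mulmxA xBI ?mulmx0.
- by rewrite !mulmxA mulmxKV // xJB ?mul0mx.
Qed.

Variables (A0 : six) (k0 : 'I_(r A0)) (a1 : 'I_4).
Hypothesis a1A0 : a1 \in val A0.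

Definition wB (a : 'I_4) : nat := if a == a1 then 1 else n.+1.
Definition wW (w : gen) : nat := if w == Gen k0 then 0 else n.+1.
Local Notation wt := (wt wB wW).
Local Notation graded := (@graded K r n wB wW).
Local Notation powm d := ((nseq d a1, Gen k0) : monomial).

Definition low deg : {set 'I_n} := [set i | (deg i < n.+1)%N]%SET.

(** One of the two elements of A differs from a1 and weighs n + 1; the other adds at least 1. *)
Lemma wW_lt (A : six) (k : 'I_(r A)) : (wW (Gen k) < \sum_(a in val A) wB a)%N.
Proof.
have wB1 a : (1 <= wB a)%N by rewrite /wB; case: ifP.
have wWn : (wW (Gen k) <= n.+1)%N by rewrite /wW; case: ifP.
have /cards2P [a [b [ab Aab]]] := valP A.
rewrite Aab big_setU1 ?inE //= big_set1.
rewrite /wB; have := wB1 a; have := wB1 b; rewrite /wB.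
have [aE|] := eqVneq a a1; have [bE|] := eqVneq b a1; try lia.
by rewrite aE bE eqxx in ab.
Qed.

Lemma wt_powm d : wt (powm d) = d.
Proof. by rewrite /wt /= big_nseq iter_addn_0 /wB /wW !eqxx mul1n addn0. Qed.

Lemma low_monomial m : (wt m < n.+1)%N -> m = powm (wt m).
Proof.
case: m => p w; elim: p => [|a p IH].
  by rewrite wt_nil /wW; case: eqP => [->|_]; rewrite ?ltnn.
rewrite wt_cons {1 3}/wB; case: eqP => [-> lt_p|_]; last by lia.
by have [-> ->] := IH (ltnW lt_p); rewrite wt_powm.
Qed.

Lemma mvec_powmS x d : mvec x (powm d.+1) = opB x a1 *m mvec x (powm d).
Proof. exact: mvec_cons. Qed.

Lemma graded_mvec x deg m i : graded x deg -> mvec x m i 0 != 0 -> deg i = wt m.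
Proof.
move=> [_ _ _ xB xI]; case: m => p [A k]; elim: p i => [|a p IH] i.
  by rewrite mvec_nil mxE wt_nil; exact: xI.
rewrite mvec_cons wt_cons mxE; apply: contra_neq_eq => deg_i.
apply: big1 => j _; apply/eqP; rewrite mulf_eq0; apply: contra_neqT deg_i.
by rewrite negb_or => /andP [/xB -> /IH ->].
Qed.

Lemma graded_low x deg i : graded x deg -> i \in low deg ->
  mvec x (powm (deg i)) = delta_mx i 0.
Proof.
move=> [[_ /(_ i) [m me mi]] _ _ _ _]; rewrite inE -mi => lt_m.
by rewrite -low_monomial.
Qed.

(** If B_a1^d w is nonzero, so are all lower powers; by homogeneity the degrees 0, ..., d all occur,
    whence d + 1 <= n. The strict bound leaves room for one more power of weight at most n. *)
Lemma graded_low_lt x deg i : graded x deg -> i \in low deg -> (deg i < n)%N.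
Proof.
move=> xg ilow.
have nz d : (d <= deg i)%N -> mvec x (powm (deg i - d)) != 0.
  elim: d => [_|d IH lt_d].
    rewrite subn0 (graded_low xg) //; apply/eqP => /colP /(_ i).
    by rewrite !mxE !eqxx => /eqP; rewrite oner_eq0.
  have := IH (ltnW lt_d); apply: contra_neq => e0.
  by rewrite -[(deg i - d)%N]prednK ?subn_gt0 // -subnS mvec_powmS e0 mulmx0.
have /choice [f fE] : forall d : 'I_(deg i).+1, exists j, deg j = d.
  move=> d; have led : (d <= deg i)%N by rewrite -ltnS.
  have := nz _ (leq_subr d (deg i)); rewrite subKn // => /cV0Pn [j] /(graded_mvec xg).
  by rewrite wt_powm; exists j.
have finj : injective f by move=> d e /(congr1 deg); rewrite !fE => /val_inj.
by have := leq_card _ finj; rewrite !card_ord.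
Qed.

(** After the change of basis g, the images of the e_i with i in S are still monomial vectors of
    weight at most n, so they lie in the low part; as g is invertible, that part has dimension at
    least #|S|. *)
Lemma regrade z (S : {set 'I_n}) : stable z -> equations z ->
  (forall i, i \in S -> exists2 m, mvec z m = delta_mx i 0 & (wt m < n.+1)%N) ->
  exists y deg, [/\ graded y deg, linked z y & (#|S| <= #|low deg|)%N].
Proof.
move=> sz ez zS; have [g [deg [gU ga]]] := adapted_act wB wW sz.
have ega := equations_act gU ez.
exists (degeneration wB wW (act g z) deg 0), deg; split.
- exact: (degeneration_graded wW_lt).
- apply: linked_trans (linked_degeneration wW_lt ga ega).
  by apply: linked_act => //; exact: stable_adapted ga.
(* A nonzero term of the Leibniz expansion of det g matches S injectively with
   low indices. *)
have [s sE] : exists s : 'S_n, forall i, g i (s i) != 0.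
  have : \det g != 0 by rewrite -unitfE -unitmxE.
  apply: contraNP => /forallNP Ns; apply/eqP/big1 => s _.
  have /existsNP [i /negP] := Ns s; rewrite negbK => /eqP gi.
  by rewrite (bigD1 i) //= gi mul0r mulr0.
rewrite -(card_imset _ (@perm_inj _ (s^-1)%g)); apply: subset_leq_card.
apply/fintype.subsetP => _ /imsetP [j jS ->]; have [m mj lt_m] := zS _ jS.
rewrite inE (leq_ltn_trans _ lt_m) //; apply: ga.1.
by rewrite mvec_act // mj -colE mxE -{2}[j](permKV s) sE.
Qed.

Lemma grade_step x deg : graded x deg -> (#|low deg| < n)%N ->
  exists y deg', [/\ graded y deg', linked x y & (#|low deg| < #|low deg'|)%N].
Proof.
move=> xg lt_n; have [xdeg ex xJ xB xI] := xg; have sx := stable_adapted xdeg.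
have [i0 i0low] : exists i0, i0 \notin low deg.
  have : low deg != [set: 'I_n]%SET.
    by apply: contraTneq lt_n => ->; rewrite cardsT card_ord ltnn.
  by rewrite -finset.subTset => /fintype.subsetPn [i _ ?]; exists i.
(* The vector e_q has top weight, and every B_a strictly raises the weight, so all the B_a kill
   it. *)
case: (arg_maxnP deg (erefl true : xpredT i0)) => q _ qmax.
have qlow : q \notin low deg.
  by move: i0low; rewrite !inE -!leqNgt => /leq_trans; apply; exact: qmax.
pose u : 'cV[K]_n := delta_mx q 0.
have wB1 a : (0 < wB a)%N by rewrite /wB; case: ifP.
have Bu a : opB x a *m u = 0.
  apply/colP => i; rewrite -colE !mxE; apply/eqP; apply: contraT => /xB.
  by have := qmax i isT; have := wB1 a; lia.
(* If the low part is empty, then w = 0 in V, since its coordinates would have weight 0; [gamma]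
   then replaces w by t u and leaves the other generators unchanged. *)
have [low0|[p0 p0low]] := set_0Vmem (low deg).
  pose beta (a : 'I_4) : 'rV[K]_n := 0.
  pose gamma (A : six) : 'rV[K]_(r A) := \row_k (Gen k == Gen k0)%:R.
  have zu t : mvec (perturb x u beta gamma t) (powm 0) = t *: u.
    rewrite mvec_nil /=; apply/colP => i; rewrite !mxE big_ord1 !mxE !eqxx mulr1.
    have [->|/xI deg_i] := eqVneq (opI x A0 i k0) 0; first by rewrite add0r.
    have : i \in low deg by rewrite inE deg_i /wW eqxx.
    by rewrite low0 inE.
  have gu t : t != 0 -> generated (perturb x u beta gamma t) u.
    move=> t0; have := generated_mvec (perturb x u beta gamma t) (powm 0).
    by move=> /(generatedZ t^-1); rewrite zu scalerK.
  have bu a : beta a *m u = 0 by rewrite mul0mx.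
  have bB a b : beta a *m opB x b = beta b *m opB x a by rewrite !mul0mx.
  have bI (A : six) c : c \in val (compl A) -> beta c *m opI x A = 0.
    by rewrite mul0mx.
  have := @regrade (perturb x u beta gamma 1) [set q]%SET.
  case.
  - exact: perturb_stable_all.
  - exact: perturb_equations.
  - by move=> i /set1P ->; exists (powm 0); rewrite ?wt_powm ?zu ?scale1r.
  move=> y [deg' [yg zy lt_y]]; exists y, deg'; split=> //.
    by apply: linked_trans zy; exact: linked_perturb.
  by rewrite low0 cards0 -(cards1 q).
case: (@arg_maxnP _ p0 (mem (low deg)) deg p0low) => p plow pmax.
have lt_p := graded_low_lt xg plow.
pose beta (a : 'I_4) : 'rV[K]_n := if a == a1 then delta_mx 0 p else 0.
pose gamma (A : six) : 'rV[K]_(r A) := 0.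
pose z t := perturb x u beta gamma t.
have pq : p != q by apply: contraNneq qlow => <-.
have bu a : beta a *m u = 0.
  rewrite /beta; case: eqP => _; last by rewrite mul0mx.
  by rewrite mul_delta_mx_0.
(* For a other than a1, the image of B_a has weight at least n + 1, above that of e_p. *)
have rowp a : a != a1 -> delta_mx 0 p *m opB x a = 0 :> 'rV_n.
  move=> aa1; apply/rowP => j; rewrite -rowE !mxE; apply/eqP; apply: contraT => /xB.
  by rewrite /wB (negbTE aa1); move: lt_p; lia.
have bB a b : beta a *m opB x b = beta b *m opB x a.
  rewrite /beta; have [->|aa1] := eqVneq a a1; have [->|bb1] := eqVneq b a1 => //.
  - by rewrite rowp // mul0mx.
  - by rewrite rowp // mul0mx.
  - by rewrite !mul0mx.
(* Only c = a1 matters. Row p of I_A can be nonzero only at the generator k0, which lives over A0;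
   but A0 contains a1 whereas A does not. *)
have bI (A : six) c : c \in val (compl A) -> beta c *m opI x A = 0.
  rewrite /beta inE; case: eqP => [->|]; last by rewrite mul0mx.
  move=> a1A; apply/rowP => k; rewrite -rowE !mxE; apply/eqP; apply: contraT => /xI.
  rewrite /wW; case: eqP => [kk0|_]; last by move: lt_p; lia.
  by move: a1A; rewrite (congr1 tag kk0 : A = A0) a1A0.
have zB t d : (opB (z t) a1 *m mvec x (powm d)) =
    mvec x (powm d.+1) + (t * mvec x (powm d) p 0) *: u.
  rewrite /= /beta eqxx mulmxDl -mvec_powmS -scalemxAl -mulmxA -rowE.
  by rewrite [row p _]mx11_scalar mul_mx_scalar scalerA mxE.
have zpow t d : (d <= deg p)%N -> mvec (z t) (powm d) = mvec x (powm d).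
  elim: d => [_|d IH lt_d].
    by rewrite !mvec_nil /= mulmx0 scaler0 addr0.
  rewrite mvec_powmS IH ?(ltnW lt_d) // zB.
  have [->|/(graded_mvec xg)] := eqVneq (mvec x (powm d) p 0) 0.
    by rewrite mulr0 scale0r addr0.
  by rewrite wt_powm => E; rewrite E ltnn in lt_d.
have zu t : mvec (z t) (powm (deg p).+1) = t *: u.
  rewrite mvec_powmS zpow // zB graded_low // mxE !eqxx mulr1.
  suff -> : mvec x (powm (deg p).+1) = 0 by rewrite add0r.
  apply/colP => i; rewrite [RHS]mxE; apply/eqP; apply: contraT => /(graded_mvec xg).
  rewrite wt_powm => deg_i; have /pmax : i \in low deg by rewrite inE deg_i.
  by rewrite deg_i /= ltnn.
have gu t : t != 0 -> generated (z t) u.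
  move=> t0; have := generated_mvec (z t) (powm (deg p).+1).
  by move=> /(generatedZ t^-1); rewrite zu scalerK.
have := @regrade (z 1) (q |: low deg)%SET.
case.
- exact: perturb_stable_all.
- exact: perturb_equations.
- move=> i /setU1P [->|ilow].
    by exists (powm (deg p).+1); rewrite ?zu ?scale1r ?wt_powm.
  exists (powm (deg i)); first by rewrite zpow ?graded_low //; exact: pmax.
  by rewrite wt_powm; move: ilow; rewrite inE.
move=> y [deg' [yg zy lt_y]]; exists y, deg'; split=> //.
  by apply: linked_trans zy; exact: linked_perturb.
by move: lt_y; rewrite cardsU1 qlow.
Qed.

Lemma linked_graded_low x : stable x -> equations x ->
  exists y deg, [/\ graded y deg, linked x y & low deg = [set: 'I_n]%SET].
Proof.
move=> sx ex; have [|y [deg [yg xy _]]] := @regrade x finset.set0 sx ex.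
  by move=> i; rewrite inE.
have [k] := ubnP (n - #|low deg|); elim: k y deg yg xy => // k IH y deg yg xy lt_k.
have [le_n|lt_n] := leqP n #|low deg|.
  by exists y, deg; split=> //; apply/eqP; rewrite eqEcard finset.subsetT cardsT card_ord.
have [z [deg' [zg yz lt_low]]] := grade_step yg lt_n.
by apply: (IH z deg') => //; [exact: linked_trans yz|move: lt_low lt_k lt_n; lia].
Qed.

(** * Uniqueness of the graded point whose low part is all of V *)

Section FullLow.
Variables (x : data) (deg : 'I_n -> nat).
Hypotheses (xg : graded x deg) (xlow : low deg = [set: 'I_n]%SET).

Lemma full_low_lt i : (deg i < n)%N.
Proof. by apply: (graded_low_lt xg); rewrite xlow inE. Qed.

Lemma full_low_mvec i : mvec x (powm (deg i)) = delta_mx i 0.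
Proof. by apply: (graded_low xg); rewrite xlow inE. Qed.

Lemma full_low_inj : injective deg.
Proof.
move=> i j ij; have := full_low_mvec i; rewrite ij full_low_mvec => /colP /(_ i) /eqP.
by rewrite !mxE !eqxx andbT; case: (i =P j) => //; rewrite eq_sym oner_eq0.
Qed.

(** The basis consists of the powers B_a1^d w, so B_a1 is a nilpotent Jordan block up to the order
    of the basis; the other B_a would raise the weight beyond n. *)
Lemma full_low_opB a i j : opB x a i j = ((a == a1) && (deg i == (deg j).+1))%:R.
Proof.
have [_ _ _ xB _] := xg; have lt_i := full_low_lt i.
have [->|aa1] /= := eqVneq a a1; last first.
  by apply/eqP; apply: contraT => /xB; rewrite /wB (negbTE aa1); lia.
have [deg_i|deg_i] := eqVneq (deg i) (deg j).+1.
  have := full_low_mvec i; rewrite deg_i mvec_powmS full_low_mvec -colE.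
  by move=> /colP /(_ i); rewrite !mxE !eqxx.
by apply/eqP; apply: contraNT deg_i => /xB ->; rewrite /wB eqxx.
Qed.

Lemma full_low_opI A i k : opI x A i k = ((Gen k == Gen k0) && (deg i == 0%N))%:R.
Proof.
have [_ _ _ _ xI] := xg; have lt_i := full_low_lt i.
have [kk0|kk0] /= := eqVneq (Gen k) (Gen k0); last first.
  by apply/eqP; apply: contraT => /xI; rewrite /wW (negbTE kk0); lia.
have [deg_i|deg_i] := eqVneq (deg i) 0%N.
  have := full_low_mvec i; rewrite deg_i /= -kk0 mvec_nil.
  by move=> /colP /(_ i); rewrite !mxE !eqxx.
by apply/eqP; apply: contraNT deg_i => /xI ->; rewrite /wW kk0 eqxx.
Qed.

End FullLow.

Lemma full_low_orbit x y deg deg' : graded x deg -> low deg = [set: 'I_n]%SET ->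
  graded y deg' -> low deg' = [set: 'I_n]%SET -> exists2 g, g \in unitmx & y = act g x.
Proof.
move=> xg xlow yg ylow.
pose rk d (dlt : forall i : 'I_n, (d i < n)%N) i := Ordinal (dlt i).
have rk_inj d dlt : injective d -> injective (@rk d dlt).
  by move=> dinj i j /(congr1 val) /dinj.
pose s := perm (rk_inj _ (full_low_lt xg xlow) (full_low_inj xg xlow)).
pose s' := perm (rk_inj _ (full_low_lt yg ylow) (full_low_inj yg ylow)).
(* Both degree functions are bijections onto 0, ..., n - 1, and c matches the basis vectors of equal
   degree. *)
pose c := (s' * s^-1)%g.
have degE i : deg (c i) = deg' i.
  have sE j : deg j = s j by rewrite permE.
  have s'E j : deg' j = s' j by rewrite permE.
  by rewrite sE s'E permM permKV.
exists (perm_mx c); first exact: unitmx_perm.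
have [_ _ xJ _ _] := xg; have [_ _ yJ _ _] := yg.
apply: tuples_ext => A /=.
- apply: (canRL (mulmxK (unitmx_perm _ _))).
  apply/matrixP => i j; rewrite -row_permE -[c]invgK -col_permE !mxE invgK.
  by rewrite (full_low_opB xg xlow) (full_low_opB yg ylow) -{2}[j](permKV c) !degE.
- apply/matrixP => i k; rewrite -row_permE mxE.
  by rewrite (full_low_opI xg xlow) (full_low_opI yg ylow) degE.
- by rewrite xJ yJ mul0mx.
Qed.

End Main.

(** * Connectedness of the moduli space *)

Lemma linked_stable (K : closedFieldType) (r : six -> nat) (n : nat)
    (x y : tuples K r n) :
  stable x -> stable y -> equations x -> equations y -> linked x y.
Proof.
case: n x y => [|n] x y sx sy ex ey.
  suff -> : y = act 1%:M x by apply: linked_act; rewrite ?act1 ?unitmx1.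
  by rewrite act1; apply: tuples_ext => A; apply/matrixP => i j; first [by case: i|by case: j].
(* As V is nonzero, a monomial basis has an element, whose generator gives a vector w in some W_A.
   The same w and a1 are used for x and y, so that both chains end in the same orbit. *)
have [f _] := stable_basis sx; have [A0 k0] := (f ord0).2.
have [a1 a1A0] : exists a1, a1 \in val A0.
  by apply/set0Pn; rewrite -card_gt0 (eqP (valP A0)).
have [x' [d [x'g xx' x'low]]] := linked_graded_low k0 a1A0 sx ex.
have [y' [e [y'g yy' y'low]]] := linked_graded_low k0 a1A0 sy ey.
have [g gU y'E] := full_low_orbit a1A0 x'g x'low y'g y'low.
apply: linked_trans xx' (linked_trans _ (linked_sym yy')); rewrite y'E.
have [x'ad ex' _ _ _] := x'g; have [y'ad _ _ _ _] := y'g.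
apply: linked_act => //; first exact: stable_adapted x'ad.
by rewrite -y'E; exact: stable_adapted y'ad.
Qed.

Lemma connected_M_Q4 (K : closedFieldType) (r : six -> nat) (n : nat) :
  connected (@M_Q4 K r n).
Proof.
have [[_ [a ea _]]|M0] := pselect (M_Q4 (K := K) (r := r) (n := n) !=set0); last first.
  by rewrite (_ : M_Q4 (n := n) = set0); [exact: connected0|apply/nonemptyPn].
suff -> : @M_Q4 K r n = connected_component (@M_Q4 K r n) (\pi_(UmodGL K r n)%qT a).
  exact: component_connected.
apply/seteqP; split; last exact: connected_component_sub.
move=> _ [b eb <-].
have sP (c : stable_tuples K r n) : stable (val c) by exact: set_valP c.
have valK (c : stable_tuples K r n) (sc : stable (val c)) :
  SigSub (mem_set sc) = c :> stable_tuples K r n by apply: val_inj.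
by have [sa [sb]] := linked_stable (sP a) (sP b) ea eb; rewrite !valK.
Qed.

(* With [connected] of MathComp-Analysis, the empty set is connected; M_Q4 is
   empty when r = 0 and n > 0. *)
Theorem theorem2p12 (R : realType) (r : six -> nat) (n : nat) :
  connected (M_Q4 (K := R[i]%C) (r := r) (n := n)).
Proof. exact: connected_M_Q4. Qed.
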